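(* Let $Z=(Z_1,\dots,Z_d)$ be a random vector in $\mathbb{R}^d$ with nonnegative integrable components and with max-characteristic function $\varphi_Z$. (i) For all $x=(x_1,\dots,x_d)$ with $x_j>0$ for every $j$, $$\Pr(Z_j\le x_j,\ 1\le j\le d)=\frac{\partial_+}{\partial t}\left\{t\,\varphi_Z\left(\frac{1}{tx}\right)\right\}\Bigr|_{t=1},$$ where $\partial_+/\partial t$ denotes the right derivative with respect to the univariate variable $t$. (ii) If $\psi:(0,\infty)^d\to\mathbb{R}$ is a continuously differentiable function such that, for all $x=(x_1,\dots,x_d)\in(0,\infty)^d$, $$\frac{\partial}{\partial t}\left\{t\,\psi\left(\frac{1}{tx}\right)\right\}\Bigr|_{t=1}=\Pr(Z_j\le x_j,\ 1\le j\le d)\quad\text{and}\quad \lim_{t\to\infty}t\left\{\psi\left(\frac{1}{tx}\right)-1\right\}=0,$$ then $\psi=\varphi_Z$ on $(0,\infty)^d$.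
   Context: The max-characteristic function of a random vector $Z$ with nonnegative integrable components is $\varphi_Z:[0,\infty)^d\to\mathbb{R}$, $\varphi_Z(x)=\mathrm{E}\{\max(1,x_1Z_1,\dots,x_dZ_d)\}$. Operations on vectors are componentwise: for $x\in(0,\infty)^d$ and $t>0$, $\frac{1}{tx}=\left(\frac{1}{tx_1},\dots,\frac{1}{tx_d}\right)$. *)

(* Defs.v *)
From mathcomp Require Import all_boot all_order all_algebra.
From mathcomp Require Import all_classical all_reals all_analysis.

Set Implicit Arguments.
Unset Strict Implicit.
Unset Printing Implicit Defensive.

Import Order.TTheory GRing.Theory Num.Theory.
Import numFieldNormedType.Exports.

Local Open Scope classical_set_scope.
Local Open Scope ring_scope.

(* 'E_P[_] is extended-real valued. For integrable nonnegative components and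
   x in [0, +oo[^n the expectation is finite, so that fine loses nothing. *)
Definition max_char {d : measure_display} {T : measurableType d} {R : realType}
    (P : probability T R) (n : nat) (Z : 'I_n -> {RV P >-> R})
    (x : 'rV[R]_n) : R :=
  fine 'E_P[fun w => \big[Num.max/1]_(j < n) (x 0 j * Z j w)].

Definition joint_cdf {d : measure_display} {T : measurableType d} {R : realType}
    (P : probability T R) (n : nat) (Z : 'I_n -> {RV P >-> R})
    (x : 'rV[R]_n) : R :=
  fine (P [set w | forall j, Z j w <= x 0 j]).

Definition pos_orthant (R : realType) (n : nat) : set 'rV[R]_n :=
  [set x | forall j, 0 < x 0 j].

(* the componentwise inverse 1 / (t x) *)
Definition inv_scale (R : realType) (n : nat) (t : R) (x : 'rV[R]_n) :
  'rV[R]_n := \row_j (t * x 0 j)^-1.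

Definition is_right_derive1 (R : realType) (f : R -> R) (a l : R) : Prop :=
  h^-1 * (f (a + h) - f a) @[h --> 0^'+] --> l.

(* For an open set U, these conditions only involve the values of f on U:
   a function on U is represented by an arbitrary total extension. *)
Definition continuously_differentiable_on (R : realType) (n : nat)
    (U : set 'rV[R]_n) (f : 'rV[R]_n -> R) : Prop :=
  forall x, U x ->
    differentiable f x /\
    {for x, continuous (fun y => \row_j 'D_(delta_mx 0 j) f y : 'rV[R]_n)}.

(* Main.v *)
Require Import Defs.
From mathcomp Require Import all_boot all_order all_algebra.
From mathcomp Require Import all_classical all_reals all_analysis.
From mathcomp Require Import measurable_realfun lra.

(** Along the ray through 1/x everything depends on one variable. With
    M = max_j Z_j / x_j, multiplying by t > 0 inside the maximum gives
    t phi_Z(1/(t x)) = E max(t, M), and the distribution function of Z at t x is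
    F(t) = P(M <= t) ([max_char_inv_scale], [joint_cdfZ]). The statement is
    therefore about G(t) = E max(t, M) for one integrable variable M.

    When t grows from a to b, max(t, M) grows by b - a if M <= a, not at all if
    M > b, and by something in between otherwise. Taking expectations,
      (b - a) F(a) <= G(b) - G(a) <= (b - a) F(b)
    ([expected_max_increment_bounds]). Dividing by b - a and using the right
    continuity of F gives (i).

    For (ii), put g(t) = t psi(1/(t x)). The hypothesis at the point t x is, by
    the chain rule, g'(t) = F(t) ([derive1_scaled]), so by the mean value theorem
    the increments of g satisfy the same two bounds as those of G. Hence
      |(g - G)(b) - (g - G)(a)| <= (b - a) (F(b) - F(a)),
    and a function with this property is constant: on a subdivision into equal
    parts the right-hand sides telescope to (b - a) (F(b) - F(a)) divided by the
    number of parts ([telescoping_constant]). Comparing increments instead of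
    derivatives copes with the kinks that G has wherever F jumps. Finally
    g(t) - t tends to 0 by hypothesis and G(t) - t = E max(M - t, 0) tends to 0 by
    dominated convergence, so that g = G; evaluating at t = 1 gives
    psi(1/x) = phi_Z(1/x). *)

Set Implicit Arguments.
Unset Strict Implicit.
Unset Printing Implicit Defensive.

Import Order.TTheory GRing.Theory Num.Theory.
Import numFieldNormedType.Exports.

Local Open Scope classical_set_scope.
Local Open Scope ring_scope.

(** * Functions determined by their increments *)

(** Halving the interval k times improves the bound by a factor 2^-k, because
    the increments of F over the pieces add up to F b - F a. *)
Lemma telescoping_constant (R : realType) (H F : R -> R) :
  (forall a b, 0 < a -> a <= b ->
    `|H b - H a| <= (b - a) * (F b - F a)) ->
  forall a b, 0 < a -> a <= b -> H b = H a.
Proof.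
move=> HF.
have bound k : forall a b, 0 < a -> a <= b ->
    `|H b - H a| * 2 ^+ k <= (b - a) * (F b - F a).
  elim: k => [|k IH] a b a0 ab; first by rewrite expr0 mulr1 HF.
  pose c := (a + b) / 2.
  have ac : a <= c by rewrite /c; lra.
  have cb : c <= b by rewrite /c; lra.
  have := IH _ _ a0 ac; have := IH _ _ (lt_le_trans a0 ac) cb.
  have -> : b - c = (b - a) / 2 by rewrite /c; lra.
  have -> : c - a = (b - a) / 2 by rewrite /c; lra.
  have tri : `|H b - H a| <= `|H b - H c| + `|H c - H a|.
    by rewrite -[H b - H a](subrKA (H c)) ler_normD.
  have := ler_wpM2r (exprn_ge0 k (ler0n R 2)) tri.
  by rewrite exprS; lra.
move=> a b a0 ab; apply/eqP; rewrite -subr_eq0 -normr_le0 leNgt.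
apply/negP => e0.
set e := `|_| in e0; set C := (b - a) * (F b - F a).
have C0 : 0 <= C.
  by apply: le_trans (bound 0%N _ _ a0 ab); rewrite mulr_ge0.
(* a positive e contradicts the bound as soon as 2 ^ k >= k > C / e *)
have := bound (Num.bound (C / e)) _ _ a0 ab; rewrite -/e -/C => /(le_trans _) le.
have := archi_boundP (divr_ge0 C0 (ltW e0)).
rewrite ltr_pdivrMr// mulrC ltNge => /negP; apply.
apply: le; rewrite ler_pM2l// -natrX ler_nat ltnW// ltn_expl//.
Qed.

(** Replaces g' = F by a condition that also makes sense for t |-> E max(t, X),
    which has a kink wherever F jumps. By the mean value theorem. *)
Lemma derive1_increment_bounds (R : realType) (g F : R -> R) :
  (forall a b, a <= b -> F a <= F b) ->
  (forall t, 0 < t -> derivable g t 1 /\ derive1 g t = F t) ->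
  forall a b, 0 < a -> a <= b ->
    (b - a) * F a <= g b - g a <= (b - a) * F b.
Proof.
move=> Fnd dg a b a0; rewrite le_eqVlt => /predU1P[<-|ab].
  by rewrite !subrr !mul0r lexx.
have der c : c \in `]a, b[ -> is_derive c 1 g (F c).
  rewrite in_itv /= => /andP[ac _]; have [gc <-] := dg _ (lt_trans a0 ac).
  by rewrite derive1E; exact/derivableP.
have cont : {within `[a, b], continuous g}.
  apply: derivable_within_continuous => c; rewrite in_itv /= => /andP[ac _].
  by have [] := dg _ (lt_le_trans a0 ac).
have [c + ->] := MVT ab der cont; rewrite in_itv /= => /andP[ac cb].
have ba : 0 <= b - a by rewrite subr_ge0 ltW.
by rewrite [F c * _]mulrC !ler_wpM2l// Fnd// ltW.
Qed.

(** * The expectation of max(t, X) as a function of t *)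

Section expected_max.
Context (d : measure_display) (T : measurableType d) (R : realType).
Variable P : probability T R.

Lemma integrable_maxr (f g : T -> R) :
  P.-integrable [set: T] (EFin \o f) -> P.-integrable [set: T] (EFin \o g) ->
  P.-integrable [set: T] (EFin \o (fun w => Num.max (f w) (g w))).
Proof.
move=> fi gi.
have := integrableD measurableT (integrable_norm fi) (integrable_norm gi).
apply: le_integrable => //.
  apply/measurable_EFinP; apply: measurable_maxr.
    by apply/measurable_EFinP; case/integrableP: fi.
  by apply/measurable_EFinP; case/integrableP: gi.
move=> w _ /=; rewrite lee_fin.
rewrite [leRHS]ger0_norm ?addr_ge0//.
by case: (leP (f w) (g w)) => _; rewrite ?lerDl ?lerDr.
Qed.

Variable X : {RV P >-> R}.
Hypothesis X_int : P.-integrable [set: T] (EFin \o X).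

Definition expected_max (t : R) : R := fine 'E_P[fun w => Num.max t (X w)].

Let F (t : R) : R := fine (cdf X t).

Lemma integrable_max_cst t :
  P.-integrable [set: T] (EFin \o (fun w => Num.max t (X w))).
Proof.
by apply: integrable_maxr => //; exact: finite_measure_integrable_cst.
Qed.

Lemma fine_cdf_homo a b : a <= b -> F a <= F b.
Proof.
by move=> ab; rewrite fine_le ?fin_num_measure//; exact: cdf_nondecreasing.
Qed.

(** Pointwise, max(b, X) - max(a, X) equals b - a when X <= a, vanishes when
    X > b and lies between these values otherwise. *)
Lemma expected_max_increment_bounds (a b : R) : a <= b ->
  (b - a) * F a <= expected_max b - expected_max a <= (b - a) * F b.
Proof.
move=> ab.
have -> : expected_max b - expected_max a =
    \int[P]_w (Num.max b (X w) - Num.max a (X w)).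
  rewrite RintegralB//; [|exact: integrable_max_cst..].
  by rewrite /expected_max !unlock.
have mle c : measurable (X @^-1` `]-oo, c]) by exact: measurable_sfunP.
have ind_int c : P.-integrable [set: T]
    (EFin \o (fun w => (b - a) * \1_(X @^-1` `]-oo, c]) w)).
  exact: (integrableZl measurableT (b - a) (integrable_indic P (mle c))).
have FE c : (b - a) * F c = \int[P]_w ((b - a) * \1_(X @^-1` `]-oo, c]) w).
  rewrite RintegralZl//; last exact: integrable_indic.
  by rewrite /Rintegral integral_indic// setIT.
have inc_int : P.-integrable [set: T]
    (EFin \o (fun w => Num.max b (X w) - Num.max a (X w))).
  exact: (integrableB measurableT (integrable_max_cst b) (integrable_max_cst a)).
have indE c w : \1_(X @^-1` `]-oo, c]) w = (X w <= c)%R%:R :> R.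
  by rewrite indicE; congr (nat_of_bool _)%:R; apply/idP/idP; rewrite inE /= in_itv.
rewrite !FE; apply/andP; split; apply: le_Rintegral => // w _; rewrite indE;
  case: (leP (X w) a) => ?; case: (leP (X w) b) => ?; rewrite ?mulr1 ?mulr0; lra.
Qed.

(** The difference quotient at a with step h lies between F a and F (a + h), and
    F is right-continuous. *)
Lemma is_right_derive1_expected_max a :
  is_right_derive1 expected_max a (F a).
Proof.
apply: (@squeeze_cvgr _ _ _ _ (cst (F a)) (fun h => F (a + h))).
- near=> h.
  have h0 : 0 < h by near: h; exact: nbhs_right_gt.
  have /expected_max_increment_bounds : a <= a + h by rewrite lerDl ltW.
  by rewrite addrAC subrr add0r /= ler_pdivlMl// ler_pdivrMl.
- exact: cvg_cst.
- have /fine_cvg/cvg_at_rightP Fa : cdf X t @[t --> a^'+] --> (F a)%:E.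
    by rewrite fineK ?fin_num_measure//; exact: cdf_right_continuous.
  apply/cvg_at_rightP => u [u0 ucvg]; apply: Fa; split.
    by move=> k; rewrite ltrDl.
  by rewrite -[X in _ --> X]addr0; apply: cvgD => //; exact: cvg_cst.
Unshelve. all: by end_near. Qed.

(** max(k, X) - k is the positive part of X - k, which vanishes as soon as
    k >= X and is dominated by |X|. *)
Lemma expected_max_sub_cvg0 :
  expected_max k%:R - k%:R @[k --> \oo] --> (0 : R).
Proof.
have -> : (fun k : nat => expected_max k%:R - k%:R) =
    fine \o (fun k : nat => (\int[P]_w (Num.max k%:R (X w) - k%:R)%:E)%E).
  apply/funext => k /=.
  rewrite -[RHS]/(\int[P]_w (Num.max k%:R (X w) - k%:R)) RintegralB//.
  - rewrite Rintegral_cst// /expected_max unlock.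
    have -> : fine (P [set: T]) = 1 by rewrite probability_setT.
    by rewrite mulr1.
  - exact: integrable_max_cst.
  - exact: finite_measure_integrable_cst.
apply: fine_cvg.
have <- : (\int[P]_(w in [set: T]) 0 = (0 : R)%:E)%E by exact: integral0.
apply: (@dominated_cvg _ _ _ P _ measurableT _ _ (EFin \o (Num.norm \o X))).
- move=> k; apply/measurable_EFinP; apply: measurable_funB => //.
  exact: measurable_maxr.
- move=> w _; apply: cvg_near_cst.
  near=> k.
  have Xk : X w <= k%:R by near: k; exact: nbhs_infty_ger.
  by rewrite max_l// subrr.
- by [].
- exact: integrable_norm.
- move=> k w _ /=; rewrite lee_fin.
  have k0 := ler0n R k.
  case: (leP (X w) k%:R) => [_|kX]; first by rewrite subrr normr0.
  by rewrite !ger0_norm; lra.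
Unshelve. all: by end_near. Qed.

(** The increments of g and of expected_max lie between the same bounds, so their
    difference is constant; its limit at infinity shows that it is 0. *)
Lemma expected_max_unique (g : R -> R) :
  (forall t, 0 < t -> derivable g t 1 /\ derive1 g t = F t) ->
  g t - t @[t --> +oo] --> (0 : R) ->
  forall t, 0 < t -> g t = expected_max t.
Proof.
move=> dg g_lim t t0.
pose H s := g s - expected_max s.
have HF a b : 0 < a -> a <= b -> `|H b - H a| <= (b - a) * (F b - F a).
  move=> a0 ab.
  have /andP[g1 g2] := derive1_increment_bounds fine_cdf_homo dg a0 ab.
  have /andP[e1 e2] := expected_max_increment_bounds ab.
  by rewrite ler_norml /H; apply/andP; split; lra.
have H0 : H k%:R @[k --> \oo] --> (0 : R).
  have -> : (fun k : nat => H k%:R) =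
      (fun k => (g k%:R - k%:R) - (expected_max k%:R - k%:R)).
    by apply/funext => k; rewrite /H; lra.
  rewrite -[X in _ --> X](subrr 0); apply: cvgB; last exact: expected_max_sub_cvg0.
  exact: (cvg_comp _ _ (@cvgr_idn R) g_lim).
have Ht : H k%:R @[k --> \oo] --> H t.
  apply: cvg_near_cst; near=> k.
  apply: telescoping_constant HF _ _ t0 _.
  by near: k; exact: nbhs_infty_ger.
apply/eqP; rewrite -subr_eq0 -/(H t); apply/eqP.
exact: (cvg_unique _ Ht H0).
Unshelve. all: by end_near. Qed.

End expected_max.

(** * Scaling along a ray of the orthant *)

Section scaling.
Context (R : realType) (n : nat).
Implicit Types x : 'rV[R]_n.

Lemma pos_orthantZ (t : R) x : 0 < t -> pos_orthant x -> pos_orthant (t *: x).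
Proof. by move=> t0 x0 j; rewrite mxE mulr_gt0. Qed.

Lemma inv_scaleZ (s t : R) x : inv_scale s (t *: x) = inv_scale (s * t) x.
Proof. by apply/rowP => j; rewrite !mxE mulrA. Qed.

Lemma pos_orthant_inv_scale (t : R) x :
  0 < t -> pos_orthant x -> pos_orthant (inv_scale t x).
Proof. by move=> t0 x0 j; rewrite mxE invr_gt0 mulr_gt0. Qed.

Lemma inv_scale1K x : inv_scale 1 (inv_scale 1 x) = x.
Proof. by apply/rowP => j; rewrite !mxE !mul1r invrK. Qed.

Lemma differentiable_inv_scale (t : R) x :
  t != 0 -> differentiable (fun s : R => inv_scale s x) t.
Proof.
move=> t0.
have -> : (fun s : R => inv_scale s x) = (fun s => s^-1 *: inv_scale 1 x).
  by apply/funext => s; apply/rowP => j; rewrite !mxE mul1r invfM.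
by apply: differentiableZl; apply/derivable1_diffP; apply: derivableV => //.
Qed.

Variable psi : 'rV[R]_n -> R.
Hypothesis psi_diff : forall x, pos_orthant x -> differentiable psi x.

Lemma derivable_scaled (t : R) x : 0 < t -> pos_orthant x ->
  derivable (fun s : R => s * psi (inv_scale s x)) t 1.
Proof.
move=> t0 x0; apply: derivableM => //.
apply/derivable1_diffP.
apply: (@differentiable_comp _ _ _ _ (fun s : R => inv_scale s x) psi).
  by apply: differentiable_inv_scale; rewrite gt_eqF.
exact/psi_diff/pos_orthant_inv_scale.
Qed.

(** Chain rule: the two functions, g on the left and g1 on the right, are related
    by g(s) = t g1(s / t), so that g'(t) = g1'(1). This turns a hypothesis on the
    derivative at 1 for all points of the ray into one at all t > 0. *)
Lemma derive1_scaled (t : R) x : 0 < t -> pos_orthant x ->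
  derive1 (fun s : R => s * psi (inv_scale s x)) t =
  derive1 (fun s : R => s * psi (inv_scale s (t *: x))) 1.
Proof.
move=> t0 x0.
set g := (X in derive1 X t = _).
have tx := derivable_scaled ltr01 (pos_orthantZ t0 x0).
have -> : g = (t \*: (fun s => s * psi (inv_scale s (t *: x)))) \o (t^-1 \*: id).
  apply/funext => s; rewrite /g /= inv_scaleZ /GRing.scale /=.
  by rewrite [t^-1 * s]mulrC divfK ?gt_eqF// mulrA mulrCA divff ?gt_eqF// mulr1.
have t1 : (t^-1 \*: id) t = 1 :> R by rewrite /= /GRing.scale /= mulVf ?gt_eqF.
rewrite derive1_comp; last 2 first.
- exact: derivableZ.
- by rewrite t1; exact: derivableZ.
rewrite t1 !derive1E !deriveZ// derive_id.
by rewrite /GRing.scale /= mulr1 mulrAC divff ?gt_eqF// mul1r.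
Qed.

End scaling.

(** * Reduction to the largest ratio Z_j / x_j *)

Section max_ratio.
Context (d : measure_display) (T : measurableType d) (R : realType).
Variables (P : probability T R) (n : nat) (Z : 'I_n -> {RV P >-> R}).
Hypothesis Z_int : forall j, P.-integrable [set: T] (EFin \o Z j).
Variable x : 'rV[R]_n.

(** The default value 0 is harmless, also for n = 0: max_ratio is only compared
    with numbers t > 0. *)
Definition max_ratio (w : T) : R :=
  \big[Num.max/0]_(j < n) ((x 0 j)^-1 * Z j w).

Lemma integrable_max_ratio : P.-integrable [set: T] (EFin \o max_ratio).
Proof.
have -> : max_ratio =
    \big[(fun f g w => Num.max (f w) (g w))/cst 0]_(j < n)
      (fun w => (x 0 j)^-1 * Z j w).
  apply/funext => w; rewrite /max_ratio.
  by elim/big_rec2: _ => //= j r f _ ->.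
elim/big_ind: _ => [|f g fi gi|j _]; first exact: finite_measure_integrable_cst.
  exact: integrable_maxr.
exact: (integrableZl measurableT (x 0 j)^-1 (Z_int j)).
Qed.

Lemma measurable_max_ratio : measurable_fun [set: T] max_ratio.
Proof. by apply/measurable_EFinP; case/integrableP: integrable_max_ratio. Qed.

Definition max_ratio_RV : {RV P >-> R} :=
  mfun_Sub (mem_set measurable_max_ratio).

Hypothesis x_gt0 : pos_orthant x.

(** Division by t > 0 commutes with maxima, and turns the terms t and Z_j / x_j
    into 1 and Z_j / (t x_j). *)
Lemma max_char_inv_scale (t : R) : 0 < t ->
  t * max_char Z (inv_scale t x) = expected_max max_ratio_RV t.
Proof.
move=> t0; have tn0 : t != 0 by rewrite gt_eqF.
have maxE : (fun w => \big[Num.max/1]_(j < n) (inv_scale t x 0 j * Z j w)) =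
    (fun w => t^-1 * Num.max t (max_ratio w)).
  apply/funext => w; rewrite /max_ratio.
  elim/big_rec2: _ => [|j r m _ ->]; first by rewrite max_l ?mulVf// ltW.
  by rewrite [in RHS]maxCA [RHS]maxr_pMr ?invr_ge0 ?ltW// mulrA mxE invfM.
rewrite /max_char maxE unlock.
rewrite -[fine _]/(\int[P]_w (t^-1 * Num.max t (max_ratio w))).
rewrite RintegralZl//; last first.
  exact: (@integrable_max_cst _ _ _ _ max_ratio_RV integrable_max_ratio).
by rewrite mulVKf// /expected_max unlock.
Qed.

Lemma joint_cdfZ (t : R) : 0 < t ->
  joint_cdf Z (t *: x) = fine (cdf max_ratio_RV t).
Proof.
move=> t0; congr (fine (P _)); apply/seteqP; split=> w /=; rewrite in_itv /=.
  move=> Zle; apply: bigmax_le => [|j _]; first exact: ltW.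
  by rewrite mulrC ler_pdivrMr// ; have := Zle j; rewrite mxE.
move=> /bigmax_leP[_ Mle] j; have := Mle j isT.
by rewrite mxE mulrC ler_pdivrMr.
Qed.

End max_ratio.

Theorem proposition2p15 (d : measure_display) (T : measurableType d)
    (R : realType) (P : probability T R) (n : nat) (Z : 'I_n -> {RV P >-> R})
    (Z_ge0 : forall (j : 'I_n) (w : T), 0 <= Z j w)
    (Z_int : forall j : 'I_n, P.-integrable [set: T] (EFin \o Z j)) :
  (forall x : 'rV[R]_n, pos_orthant x ->
    is_right_derive1 (fun t : R => t * max_char Z (inv_scale t x)) 1
      (joint_cdf Z x)) /\
  (forall psi : 'rV[R]_n -> R,
    continuously_differentiable_on (@pos_orthant R n) psi ->
    (forall x : 'rV[R]_n, pos_orthant x ->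
      derive1 (fun t : R => t * psi (inv_scale t x)) 1 = joint_cdf Z x /\
      t * (psi (inv_scale t x) - 1) @[t --> +oo] --> (0 : R)) ->
    forall x : 'rV[R]_n, pos_orthant x -> psi x = max_char Z x).
Proof.
split=> [x x0|psi psi_C1 psi_hyp y y0].
  have M_int := integrable_max_ratio Z_int x.
  rewrite -[x in joint_cdf Z x]scale1r (joint_cdfZ Z_int)//.
  have : is_right_derive1 (expected_max (max_ratio_RV Z_int x)) 1
      (fine (cdf (max_ratio_RV Z_int x) 1)).
    exact: is_right_derive1_expected_max.
  apply: cvg_trans; apply: near_eq_cvg; near=> h.
  have h0 : 0 < h by near: h; exact: nbhs_right_gt.
  by rewrite !(max_char_inv_scale Z_int)// ?addr_gt0.
(* psi and max_char are compared at 1/x, so x has to be 1/y *)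
pose x := inv_scale 1 y.
have x0 : pos_orthant x by exact: pos_orthant_inv_scale.
have psi_diff z : pos_orthant z -> differentiable psi z by case/psi_C1.
have -> : y = inv_scale 1 x by rewrite inv_scale1K.
rewrite -[LHS]mul1r -[RHS]mul1r (max_char_inv_scale Z_int)//.
apply: (expected_max_unique _ (g := fun t => t * psi (inv_scale t x))) => //.
- exact: integrable_max_ratio.
- move=> t t0; split; first exact: derivable_scaled.
  rewrite derive1_scaled// -(joint_cdfZ Z_int)//.
  by have [] := psi_hyp _ (pos_orthantZ t0 x0).
- have [_] := psi_hyp _ x0; apply: cvg_trans; apply: near_eq_cvg.
  by near=> t; rewrite mulrBr mulr1.
Unshelve. all: by end_near. Qed.
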